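(* Let $f,g,A,Q_1,Q_2,d$ and the constants be as in the context, and let $\{w_k\}$, $\{\alpha_k\}$, $\{\mu_k\}$ be the sequences produced by the excessive gap minimization algorithm described in the context. Then the update rule of the algorithm guarantees that the excessive gap condition is satisfied for all $k\ge1$: $$J_{\mu_k}(w_k)\le D(\alpha_k)\quad\text{for all }k\ge 1,\qquad\text{and}\qquad \lim_{k\to\infty}\mu_k=0.$$
   Context: Definitions. A convex function $h:\mathbb R^n\to\mathbb R\cup\{\infty\}$ is strongly convex with respect to a norm $\|\cdot\|$ if there is a constant $\rho>0$ such that $h-\frac{\rho}{2}\|\cdot\|^2$ is convex; then $h$ is called $\rho$-strongly convex. A function $h:\mathbb R^n\to\mathbb R\cup\{\infty\}$ that is differentiable on $Q\subseteq\mathbb R^n$ has Lipschitz continuous gradient with respect to a norm $\|\cdot\|$ if there is a constant $L$ with $\|\nabla h(w)-\nabla h(w')\|\le L\|w-w'\|$ for all $w,w'\in Q$; then $h$ is called $L$-l.c.g. Setting. $Q_1$ and $Q_2$ are subsets of Euclidean spaces, $A$ is a linear map from the space containing $Q_1$ to the space containing $Q_2$, with transpose $A^\top$, and $f$, $g$ are convex functions defined on $Q_1$ and $Q_2$ respectively. Assumptions: (a) $Q_2$ is compact; (b) with respect to a certain norm on $Q_1$, $f$ is $\rho$-strongly convex (not necessarily l.c.g.); (c) with respect to a certain norm on $Q_2$, $g$ is convex and $L_g$-l.c.g. (not necessarily strongly convex). The prox-function $d$ is a $\sigma$-strongly convex (with respect to the norm on $Q_2$) smooth function with $\min_{\alpha\in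 Q_2}d(\alpha)=0$, $\alpha_0:=\operatorname{argmin}_{\alpha\in Q_2}d(\alpha)$ and $\max_{\alpha\in Q_2}d(\alpha)<\infty$. Smoothed primal objective (for $\mu>0$) and dual objective: $$J_\mu(w)=f(w)+\max_{\alpha\in Q_2}\{\langle Aw,\alpha\rangle-g(\alpha)-\mu d(\alpha)\}\ (w\in Q_1),\qquad D(\alpha)=-g(\alpha)-\max_{w\in Q_1}\{\langle -Aw,\alpha\rangle-f(w)\}\ (\alpha\in Q_2).$$ With $J(w)=f(w)+\max_{\alpha\in Q_2}\{\langle Aw,\alpha\rangle-g(\alpha)\}$, mild constraint qualifications are assumed to hold, so that $\inf_{w\in Q_1}J(w)=\sup_{\alpha\in Q_2}D(\alpha)$ and $J(w)\ge D(\alpha)$ for all $w\in Q_1,\alpha\in Q_2$. Constants: $\|A\|_{1,2}:=\max\{\langle Aw,\alpha\rangle:\|w\|=\|\alpha\|=1\}$, and $L$ denotes the l.c.g. modulus of $-D$, namely $L=\|A\|_{1,2}^2/\rho+L_g$. Maps: for $\mu>0$, $w(\alpha):=\operatorname{argmax}_{w\in Q_1}\{\langle -Aw,\alpha\rangle-f(w)\}$ and $\alpha_\mu(w):=\operatorname{argmax}_{\alpha\in Q_2}\{\langle Aw,\alpha\rangle-g(\alpha)-\mu d(\alpha)\}$. Bregman divergence: $\Delta(\bar\alpha,\alpha):=d(\bar\alpha)-d(\alpha)-\langle\nabla d(\alpha),\bar\alpha-\alpha\rangle$. Bregman projection: $V(\alpha,u):=\operatorname{argmin}_{\bar\alpha\in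 Q_2}\{\Delta(\bar\alpha,\alpha)+\langle u,\bar\alpha-\alpha\rangle\}$. Algorithm. Initialize $\mu_1=L/\sigma$, $w_1=w(\alpha_0)$, $\alpha_1=V\big(\alpha_0,-\tfrac1{\mu_1}\nabla D(\alpha_0)\big)$. For $k=1,2,\dots$ set $\tau_k=\frac{2}{k+3}$ and $\hat\alpha=(1-\tau_k)\alpha_k+\tau_k\alpha_{\mu_k}(w_k)$; $w_{k+1}=(1-\tau_k)w_k+\tau_k w(\hat\alpha)$; $\tilde\alpha=V\big(\alpha_{\mu_k}(w_k),\tfrac{-\tau_k}{(1-\tau_k)\mu_k}\nabla D(\hat\alpha)\big)$; $\alpha_{k+1}=(1-\tau_k)\alpha_k+\tau_k\tilde\alpha$; $\mu_{k+1}=(1-\tau_k)\mu_k$.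
   Formalization: The claim fails for general norms as literally defined; here gradient differences are measured in the dual norm, and ρ-strong convexity means h(tx+(1-t)y) ≤ t h(x)+(1-t)h(y) - (ρ/2)t(1-t)‖x-y‖² (both agree for the Euclidean norm). L>0 and attainment of the max over Q_1 are explicit. *)

(* Defs.v *)
From mathcomp Require Import all_boot all_order all_algebra.
From mathcomp Require Import all_classical all_reals all_analysis.
From mathcomp Require Import ring.

Set Implicit Arguments.
Unset Strict Implicit.
Unset Printing Implicit Defensive.

Import Order.TTheory GRing.Theory Num.Theory.
Import numFieldNormedType.Exports.

Local Open Scope classical_set_scope.
Local Open Scope ring_scope.

(* Points are row vectors: the linear map called A acts by w |-> w *m A, where
   A : 'M[R]_(m, n). The library norm and topology on 'rV[R]_n only serve to
   express compactness and differentiability, which in finite dimension do not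
   depend on the norm; the norms of the optimization problem are arbitrary
   functions N satisfying is_norm. *)

Section Vectors.
Context {R : realType}.

Definition dot n (u v : 'rV[R]_n) : R := \sum_(i < n) u 0 i * v 0 i.

Definition is_norm n (N : 'rV[R]_n -> R) : Prop :=
  [/\ forall x y, N (x + y) <= N x + N y,
      forall (a : R) x, N (a *: x) = `|a| * N x
    & forall x, N x = 0 -> x = 0].

Definition dual_norm n (N : 'rV[R]_n -> R) (s : 'rV[R]_n) : R :=
  sup [set dot s x | x in [set x | N x <= 1]].

(* The junk value of sup on the empty set, 0, is the right one when m or n
   is 0. *)
Definition op_norm m n (N1 : 'rV[R]_m -> R) (N2 : 'rV[R]_n -> R)
    (A : 'M[R]_(m, n)) : R :=
  sup [set dot (p.1 *m A) p.2 | p in [set p | N1 p.1 = 1 /\ N2 p.2 = 1]].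

Definition grad n (h : 'rV[R]_n -> R) (x : 'rV[R]_n) : 'rV[R]_n :=
  \row_i 'D_(delta_mx 0 i) h x.

Definition is_argmax n (Q : set 'rV[R]_n) (F : 'rV[R]_n -> R) (x : 'rV[R]_n) :=
  Q x /\ forall y, Q y -> F y <= F x.

Definition argmax n (Q : set 'rV[R]_n) (F : 'rV[R]_n -> R) : 'rV[R]_n :=
  xget 0 [set x | is_argmax Q F x].

Definition is_argmin n (Q : set 'rV[R]_n) (F : 'rV[R]_n -> R) (x : 'rV[R]_n) :=
  Q x /\ forall y, Q y -> F x <= F y.

Definition argmin n (Q : set 'rV[R]_n) (F : 'rV[R]_n -> R) : 'rV[R]_n :=
  xget 0 [set x | is_argmin Q F x].

(* Functions with values in R \cup {oo} that are finite on Q are represented by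
   total real functions of which only the values on Q (and, for
   differentiability, near Q) are used. *)

(* For a norm coming from an inner product this says that h - rho/2 N^2 is
   convex on Q (strongly_convex_quadE below). For other norms that condition
   does not bound the curvature of h: N^2 may be constant on a segment. *)
Definition strongly_convex n (rho : R) (N : 'rV[R]_n -> R) (Q : set 'rV[R]_n)
    (h : 'rV[R]_n -> R) : Prop :=
  0 < rho /\
  forall (t : R) x y, 0 <= t <= 1 -> Q x -> Q y ->
    h (t *: x + (1 - t) *: y)
      <= t * h x + (1 - t) * h y - rho / 2 * (t * (1 - t)) * N (x - y) ^+ 2.

(* Gradients are linear forms, hence are measured in the dual norm. *)
Definition lcg n (L : R) (N : 'rV[R]_n -> R) (Q : set 'rV[R]_n)
    (h : 'rV[R]_n -> R) : Prop :=
  (forall x, Q x -> differentiable h x) /\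
  forall x y, Q x -> Q y -> dual_norm N (grad h x - grad h y) <= L * N (x - y).

Lemma strongly_convex_quadE n (rho : R) (N : 'rV[R]_n -> R) (P : 'M[R]_n)
    (Q : set 'rV[R]_n) (h : 'rV[R]_n -> R) :
  (forall x, N x ^+ 2 = dot (x *m P) x) ->
  strongly_convex rho N Q h <->
  0 < rho /\ convex_function Q (fun x => h x - rho / 2 * N x ^+ 2).
Proof.
move=> NP.
have dotDl u v w : dot (u + v) w = dot u w + dot v w :> R.
  by rewrite /dot -big_split; apply: eq_bigr => i _ /=; rewrite mxE mulrDl.
have dotDr u v w : dot w (u + v) = dot w u + dot w v :> R.
  by rewrite /dot -big_split; apply: eq_bigr => i _ /=; rewrite mxE mulrDr.
have dotZl (a : R) u w : dot (a *: u) w = a * dot u w.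
  by rewrite /dot mulr_sumr; apply: eq_bigr => i _ /=; rewrite mxE mulrA.
have dotZr (a : R) u w : dot w (a *: u) = a * dot w u.
  by rewrite /dot mulr_sumr; apply: eq_bigr => i _ /=; rewrite mxE; ring.
have key (t : R) x y : N (t *: x + (1 - t) *: y) ^+ 2
    = t * N x ^+ 2 + (1 - t) * N y ^+ 2 - t * (1 - t) * N (x - y) ^+ 2.
  rewrite -[- y]scaleN1r !NP !mulmxDl -!scalemxAl !(dotDl, dotDr, dotZl, dotZr).
  by ring.
have eqv (t hx hy hz a b c : R) :
    (hz <= t * hx + (1 - t) * hy - rho / 2 * (t * (1 - t)) * c)
    = (hz - rho / 2 * (t * a + (1 - t) * b - t * (1 - t) * c)
       <= t * (hx - rho / 2 * a) + (1 - t) * (hy - rho / 2 * b)).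
  by rewrite -subr_ge0 -[RHS]subr_ge0; congr (0 <= _); ring.
split=> -[rho0 H]; split=> //.
  move=> t x y /set_mem Qx /set_mem Qy.
  have t01 : 0 <= t%:num <= 1 by rewrite ge0 le1.
  by have := H t%:num x y t01 Qx Qy; rewrite (eqv _ _ _ _ (N x ^+ 2) (N y ^+ 2)) -key.
move=> t x y t01 Qx Qy; have /andP[t0 t1] := t01.
rewrite (eqv _ _ _ _ (N x ^+ 2) (N y ^+ 2)) -key.
exact: (H (Itv01 t0 t1) x y (mem_set Qx) (mem_set Qy)).
Qed.

End Vectors.

Section ExcessiveGap.
Context {R : realType} (m n : nat).
Variables (Q1 : set 'rV[R]_m) (Q2 : set 'rV[R]_n).
Variables (f : 'rV[R]_m -> R) (g d : 'rV[R]_n -> R) (A : 'M[R]_(m, n)).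

Definition primal (w : 'rV[R]_m) : R :=
  f w + sup [set dot (w *m A) a - g a | a in Q2].

Definition smoothed_primal (mu : R) (w : 'rV[R]_m) : R :=
  f w + sup [set dot (w *m A) a - g a - mu * d a | a in Q2].

Definition dual_fun (a : 'rV[R]_n) : R :=
  - g a - sup [set dot (- (w *m A)) a - f w | w in Q1].

Definition w_of (a : 'rV[R]_n) : 'rV[R]_m :=
  argmax Q1 (fun w => dot (- (w *m A)) a - f w).

Definition alpha_of (mu : R) (w : 'rV[R]_m) : 'rV[R]_n :=
  argmax Q2 (fun a => dot (w *m A) a - g a - mu * d a).

Definition bregman (b a : 'rV[R]_n) : R := d b - d a - dot (grad d a) (b - a).

Definition bregman_proj (a u : 'rV[R]_n) : 'rV[R]_n :=
  argmin Q2 (fun b => bregman b a + dot u (b - a)).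

(* The sequences start at index 1; their values at 0 are irrelevant. *)
Definition egm_sequences (L sigma : R) (alpha0 : 'rV[R]_n)
    (w : nat -> 'rV[R]_m) (alpha : nat -> 'rV[R]_n) (mu : nat -> R) : Prop :=
  [/\ mu 1%N = L / sigma,
      w 1%N = w_of alpha0,
      alpha 1%N = bregman_proj alpha0 (- (mu 1%N)^-1 *: grad dual_fun alpha0)
    & forall k : nat, (1 <= k)%N ->
      let tau : R := 2 / (k + 3)%:R in
      let alpha_mu := alpha_of (mu k) (w k) in
      let alpha_hat := (1 - tau) *: alpha k + tau *: alpha_mu in
      let alpha_tilde := bregman_proj alpha_mu
        ((- tau / ((1 - tau) * mu k)) *: grad dual_fun alpha_hat) in
      [/\ w k.+1 = (1 - tau) *: w k + tau *: w_of alpha_hat,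
          alpha k.+1 = (1 - tau) *: alpha k + tau *: alpha_tilde
        & mu k.+1 = (1 - tau) * mu k]].

End ExcessiveGap.

(* Main.v *)
(** The conjugate term a |-> sup_w (<-Aw, a> - f w) of the dual objective lies,
    around a point a of Q2, between its linearization <-A w(a), .> - f (w(a)) and
    this linearization plus |A|^2/(2 rho) |. - a|^2: strong convexity of f at the
    maximizer w(a) absorbs the cross term by Young's inequality. Hence D is
    differentiable at a with gradient A w(a) - grad g a, and satisfies the
    descent inequality with constant L on Q2; D is also concave there.

    Base case: descent at alpha0 and sigma/2 |.|^2 <= Bregman distance give
    D(alpha1) >= D(alpha0) + max_b {<grad D(alpha0), b - alpha0> - mu1 Delta(b, alpha0)},
    where Delta(b, alpha0) <= d b because alpha0 minimizes d, and convexity of g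
    bounds the right-hand side below by J_mu1(w1).

    Inductive step: for every b in Q2 the objective of J_mu+(w+) at b is at most
    (1 - tau) (J_mu(w) - mu Delta(b, alpha_mu)) + tau (linearization of D at alpha^),
    and J_mu(w) <= D(alpha) <= its linearization at alpha^. The directions combine to
    tau (b - alpha_mu), so b may be replaced by the Bregman projection alpha~, and
    descent concludes as soon as L tau^2 <= (1 - tau) mu sigma. This last condition
    holds since mu_k = 6 L / (sigma (k + 1) (k + 2)). *)

Require Import Defs.
From mathcomp Require Import all_boot all_order all_algebra.
From mathcomp Require Import all_classical all_reals all_analysis.
From mathcomp Require Import ring lra.

Import Order.TTheory GRing.Theory Num.Theory.
Import numFieldNormedType.Exports.

Local Open Scope classical_set_scope.
Local Open Scope ring_scope.

(** * Bilinearity and continuity of the inner product *)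

Section Dot.
Context {R : realType} {n : nat}.
Implicit Types (u v w x : 'rV[R]_n) (a : R).

Lemma dotC u v : dot u v = dot v u.
Proof. by apply: eq_bigr => i _; rewrite mulrC. Qed.

Lemma dotDl u v w : dot (u + v) w = dot u w + dot v w.
Proof. by rewrite /dot -big_split; apply: eq_bigr => i _; rewrite mxE mulrDl. Qed.

Lemma dotZl a u w : dot (a *: u) w = a * dot u w.
Proof. by rewrite /dot mulr_sumr; apply: eq_bigr => i _; rewrite mxE mulrA. Qed.

Lemma dotNl u w : dot (- u) w = - dot u w.
Proof. by rewrite -scaleN1r dotZl mulN1r. Qed.

Lemma dotBl u v w : dot (u - v) w = dot u w - dot v w.
Proof. by rewrite dotDl dotNl. Qed.

Lemma dotDr u v w : dot u (v + w) = dot u v + dot u w.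
Proof. by rewrite dotC dotDl !(dotC u). Qed.

Lemma dotZr a u w : dot u (a *: w) = a * dot u w.
Proof. by rewrite dotC dotZl dotC. Qed.

Lemma dotNr u w : dot u (- w) = - dot u w.
Proof. by rewrite dotC dotNl dotC. Qed.

Lemma dotBr u v w : dot u (v - w) = dot u v - dot u w.
Proof. by rewrite dotDr dotNr. Qed.

Lemma dotv0 u : dot u 0 = 0.
Proof. by rewrite -(scale0r 0) dotZr mul0r. Qed.

Lemma dot_deltar u i : dot u (delta_mx 0 i) = u 0 i.
Proof.
rewrite /dot (bigD1 i) //= big1 => [|j ji]; rewrite mxE eqxx.
  by rewrite eqxx mulr1 addr0.
by rewrite (negPf ji) mulr0.
Qed.

Lemma ler_coord_norm x i : `|x 0 i| <= `|x|.
Proof.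
rewrite [leRHS]/Num.Def.normr /= mx_normrE.
exact: (@le_bigmax _ _ _ 0 (fun ij : 'I_1 * 'I_n => `|x ij.1 ij.2|) (0, i)).
Qed.

Lemma ler_norm_dot u x : `|dot u x| <= (\sum_i `|u 0 i|) * `|x|.
Proof.
rewrite mulr_suml; apply: (le_trans (ler_norm_sum _ _ _)).
by apply: ler_sum => i _; rewrite normrM ler_wpM2l// ler_coord_norm.
Qed.

Lemma lipschitz_continuous_rV (F : 'rV[R]_n -> R) C :
  (forall x y, `|F x - F y| <= C * `|x - y|) -> continuous F.
Proof.
move=> FC x; apply: (iffRL (@cvgrPdist_le _ _ _ (nbhs x) _ F (F x))) => e e0.
(* [C] carries no sign assumption; [|C| + 1] is safe to divide by. *)
have C1 : 0 < `|C| + 1 by rewrite ltr_wpDl.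
apply: filterS (nbhsx_ballx x _ (divr_gt0 e0 C1)) => y.
rewrite -ball_normE => /ltW /= yx; apply: (le_trans (FC x y)).
apply: (@le_trans _ _ ((`|C| + 1) * `|x - y|)).
  by rewrite ler_wpM2r // (le_trans (ler_norm C)) // lerDl.
by rewrite mulrC -ler_pdivlMr.
Qed.

Lemma dot_continuous u : continuous (dot u).
Proof.
by apply: lipschitz_continuous_rV => x y; rewrite -dotBr; exact: ler_norm_dot.
Qed.

End Dot.

(** * Arbitrary norms, dual norms and operator norms *)

Section ArbitraryNorm.
Context {R : realType} {n : nat} (N : 'rV[R]_n -> R).
Hypothesis N_norm : is_norm N.
Implicit Types x y : 'rV[R]_n.

Lemma is_norm0 : N 0 = 0.
Proof. by case: N_norm => _ NZ _; rewrite -(scale0r 0) NZ normr0 mul0r. Qed.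

Lemma is_normN x : N (- x) = N x.
Proof. by case: N_norm => _ NZ _; rewrite -scaleN1r NZ normrN1 mul1r. Qed.

Lemma is_norm_ge0 x : 0 <= N x.
Proof.
case: N_norm => ND _ _; have := ND x (- x).
by rewrite subrr is_norm0 is_normN -mulr2n pmulrn_lge0.
Qed.

Lemma is_norm_le_norm x : N x <= (\sum_i N (delta_mx 0 i)) * `|x|.
Proof.
case: (N_norm) => ND NZ _.
rewrite {1}[x]row_sum_delta mulr_suml.
elim/big_ind2: _ => [|a b c e ab ce|i _]; first by rewrite is_norm0.
  exact: le_trans (ND _ _) (lerD ab ce).
by rewrite NZ mulrC ler_wpM2l ?is_norm_ge0// ler_coord_norm.
Qed.

Lemma is_norm_continuous : continuous N.
Proof.
case: (N_norm) => ND _ _.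
have NB (a b : 'rV[R]_n) : N a - N b <= N (a - b).
  by rewrite lerBlDr (le_trans _ (ND _ _)) // subrK.
apply: lipschitz_continuous_rV => x y; apply: le_trans (is_norm_le_norm _).
by rewrite ler_norml lerNl opprB NB andbT -(is_normN (x - y)) opprB NB.
Qed.

(* N is bounded away from 0 on the compact unit sphere of the library norm. *)
Lemma norm_le_is_norm : exists2 c, 0 <= c & forall x, `|x| <= c * N x.
Proof.
case: (N_norm) => _ NZ N_eq0.
pose S : set 'rV[R]_n := [set x | `|x| = 1].
(* The sphere is empty only if every vector is zero, and then the constant 0 works. *)
have [[x0 Sx0]|S0] := pselect (S !=set0); last first.
  exists 0 => // x; rewrite mul0r normr_le0; apply: contrapT => /negP x0.
  apply: S0; exists (`|x|^-1 *: x).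
  by rewrite /S /= normrZ normfV normr_id mulVf // normr_eq0.
have S_compact : compact S.
  apply: bounded_closed_compact.
    by exists 1; split => // M M1 x; rewrite /S /= => ->; exact: ltW.
  apply: (@preimage_closed _ _ (fun x : 'rV[R]_n => `|x|) [set r | r = 1]).
    by move=> x _; exact: norm_continuous.
  exact: closed_eq.
have [|x1 /set_mem Sx1 x1_min] := @EVT_min_rV R n N S (ex_intro _ _ Sx0) S_compact.
  by apply: continuous_subspaceT; exact: is_norm_continuous.
have Nx1 : 0 < N x1.
  rewrite lt_neqAle is_norm_ge0 andbT eq_sym; apply/eqP => /N_eq0 x1_0.
  by move: Sx1; rewrite /S /= x1_0 normr0 => /eqP; rewrite eq_sym oner_eq0.
exists (N x1)^-1 => [|x]; first by rewrite invr_ge0 ltW.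
have [->|x_neq0] := eqVneq x 0; first by rewrite normr0 is_norm0 mulr0.
have nx : 0 < `|x| by rewrite normr_gt0.
have := x1_min (`|x|^-1 *: x).
have Sx : S (`|x|^-1 *: x) by rewrite /S /= normrZ normfV normr_id mulVf // gt_eqF.
move=> /(_ (mem_set Sx)); rewrite NZ normfV normr_id.
by rewrite -ler_pdivrMl ?invr_gt0// invrK mulrC -ler_pdivlMl.
Qed.

(** Scaling [x] to norm one puts the scaled product in the set under [sup]. A real [sup] bounds its
    set only if the set is bounded above, which norm equivalence supplies. *)
Lemma dot_le_dual_norm s x : dot s x <= dual_norm N s * N x.
Proof.
case: (N_norm) => _ NZ N_eq0.
have [c c0 cN] := norm_le_is_norm.
have [/N_eq0 ->|Nx_neq0] := eqVneq (N x) 0; first by rewrite dotv0 is_norm0 mulr0.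
have Nx : 0 < N x by rewrite lt_neqAle eq_sym Nx_neq0 is_norm_ge0.
rewrite -ler_pdivrMr // mulrC -dotZr; apply: ub_le_sup.
  exists ((\sum_i `|s 0 i|) * c) => _ [y /= Ny <-].
  apply: (le_trans (ler_norm _)); apply: (le_trans (ler_norm_dot _ _)).
  rewrite ler_wpM2l ?sumr_ge0 // (le_trans (cN _)) // ler_piMr //.
by exists ((N x)^-1 *: x) => //=; rewrite NZ gtr0_norm ?invr_gt0 // mulVf.
Qed.

End ArbitraryNorm.

Lemma mulmx_norm_bounded {R : realType} {m n : nat} (A : 'M[R]_(m, n)) :
  exists2 K, 0 <= K & forall x : 'rV[R]_m, \sum_j `|(x *m A) 0 j| <= K * `|x|.
Proof.
exists (\sum_j \sum_i `|A i j|) => [|x]; first by do 2!apply: sumr_ge0 => ? _.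
rewrite mulr_suml; apply: ler_sum => j _; rewrite mxE mulr_suml.
apply: (le_trans (ler_norm_sum _ _ _)); apply: ler_sum => i _.
by rewrite normrM mulrC ler_wpM2l // ler_coord_norm.
Qed.

(** Both nonzero vectors are normalized; boundedness of the set under [sup] follows from norm
    equivalence and from a bound by the entries of [A]. *)
Lemma dot_le_op_norm {R : realType} {m n : nat}
    (N1 : 'rV[R]_m -> R) (N2 : 'rV[R]_n -> R) (A : 'M[R]_(m, n)) x y :
  is_norm N1 -> is_norm N2 -> dot (x *m A) y <= op_norm N1 N2 A * (N1 x * N2 y).
Proof.
move=> N1n N2n; case: (N1n) => _ N1Z N1_eq0; case: (N2n) => _ N2Z N2_eq0.
have [c1 c10 cN1] := norm_le_is_norm _ N1n.
have [c2 c20 cN2] := norm_le_is_norm _ N2n.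
have [K K0 KA] := mulmx_norm_bounded A.
have [/N1_eq0 ->|Nx_neq0] := eqVneq (N1 x) 0.
  by rewrite mul0mx dotC dotv0 is_norm0 // mul0r mulr0.
have [/N2_eq0 ->|Ny_neq0] := eqVneq (N2 y) 0.
  by rewrite dotv0 is_norm0 // !mulr0.
have Nx : 0 < N1 x by rewrite lt_neqAle eq_sym Nx_neq0 is_norm_ge0.
have Ny : 0 < N2 y by rewrite lt_neqAle eq_sym Ny_neq0 is_norm_ge0.
rewrite -ler_pdivrMr ?mulr_gt0 // invfM mulrC -mulrA -dotZr -dotZl scalemxAl.
apply: ub_le_sup.
  exists (K * c1 * c2) => _ [[p q] /= [N1p N2q] <-].
  apply: (le_trans (ler_norm _)); apply: (le_trans (ler_norm_dot _ _)).
  apply: ler_pM; rewrite ?sumr_ge0 //.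
    by apply: (le_trans (KA _)); rewrite ler_wpM2l // (le_trans (cN1 _)) // N1p mulr1.
  by rewrite (le_trans (cN2 _)) // N2q mulr1.
exists ((N1 x)^-1 *: x, (N2 y)^-1 *: y) => //=.
by rewrite N1Z N2Z !gtr0_norm ?invr_gt0 // !mulVf.
Qed.

(** * Directional derivatives and gradients *)

Section DirectionalDerivative.
Context {R : realType} {n : nat}.
Implicit Types (h : 'rV[R]_n -> R) (x y v : 'rV[R]_n).

Lemma derive_grad h x v : differentiable h x -> 'D_v h x = dot (grad h x) v.
Proof.
move=> hx; rewrite deriveE // {1}[v]row_sum_delta linear_sum.
by apply: eq_bigr => i _; rewrite linearZ mxE deriveE // mulrC.
Qed.

(** Only the limit from the right is taken, so a bound along a segment inside a convex set suffices,
    even at its boundary. The slack [t * e] in the slope vanishes in the limit. *)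
Lemma derive_le h x v c e : derivable h x v ->
  (forall t : R, 0 < t < 1 -> h (x + t *: v) - h x <= t * (c + t * e)) ->
  'D_v h x <= c.
Proof.
move=> hx hle; have ce : c + t * e @[t --> (0 : R)^'+] --> c.
  rewrite -[X in _ --> X]addr0 -[X in _ --> _ + X](mul0r e).
  apply: cvgD; first exact: cvg_cst.
  apply: cvgM; last exact: cvg_cst.
  by apply: cvg_at_right_filter; exact: cvg_id.
apply: ler_cvg_to (cvg_dnbhs_at_right hx) ce _.
near=> t; have t01 : 0 < t < 1.
  by apply/andP; split; near: t; [exact: nbhs_right_gt | exact: nbhs_right_lt].
have t0 : 0 < t by case/andP: t01.
by rewrite /= [_ *: v + x]addrC ler_pdivrMl // hle.
Unshelve. all: by end_near. Qed.

Lemma derive_ge h x v c : derivable h x v ->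
  (forall t : R, 0 < t < 1 -> t * c <= h (x + t *: v) - h x) -> c <= 'D_v h x.
Proof.
move=> hx hge; rewrite -lerN2 -deriveN //.
apply: (@derive_le _ _ _ _ 0); first exact: derivableN.
by move=> t /hge; rewrite !fctE; lra.
Qed.

Lemma is_derive_line h x v (t : R) : derivable h (x + t *: v) v ->
  is_derive t 1 (fun s : R => h (x + s *: v)) ('D_v h (x + t *: v)).
Proof.
move=> hx.
have E : (fun e : R => e^-1 *: (((fun s => h (x + s *: v)) \o shift t) (e *: 1)
            - h (x + t *: v)))
       = (fun e => e^-1 *: ((h \o shift (x + t *: v)) (e *: v) - h (x + t *: v))).
  apply/funext => e /=; congr (_ *: (h _ - _)).
  by rewrite [e *: 1]mulr1 scalerDl addrCA.
by apply: DeriveDef; rewrite ?/derivable ?/derive E.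
Qed.

End DirectionalDerivative.

(** * First-order inequalities on convex sets *)

Lemma convex_setP {R : realType} {n : nat} (Q : set 'rV[R]_n) x y (t : R) :
  convex_set Q -> Q x -> Q y -> 0 <= t <= 1 -> Q (t *: x + (1 - t) *: y).
Proof.
move=> Qc Qx Qy /andP[t0 t1].
exact/set_mem/(Qc x y (Itv01 t0 t1) (mem_set Qx) (mem_set Qy)).
Qed.

Lemma convex_set_segment {R : realType} {n : nat} (Q : set 'rV[R]_n) x y (t : R) :
  convex_set Q -> Q x -> Q y -> 0 <= t <= 1 -> Q (x + t *: (y - x)).
Proof.
move=> Qc Qx Qy t01; have := convex_setP _ _ _ _ Qc Qy Qx t01.
by rewrite scalerBl scale1r scalerBr addrCA.
Qed.

(** Along the segment, [h] minus its quadratic model has nonpositive derivative, since the dual-norm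
    inequality turns the gradient bound into a bound on slopes. The mean value theorem concludes. *)
Lemma lcg_descent {R : realType} {n : nat} (L : R) (N : 'rV[R]_n -> R)
    (Q : set 'rV[R]_n) (h : 'rV[R]_n -> R) x y :
  is_norm N -> convex_set Q -> lcg L N Q h -> Q x -> Q y ->
  h y <= h x + dot (grad h x) (y - x) + L / 2 * N (y - x) ^+ 2.
Proof.
move=> N_norm Qc [h_diff h_lip] Qx Qy; set v : 'rV[R]_n := y - x.
case: (N_norm) => _ NZ _.
have Qt (t : R) : 0 <= t <= 1 -> Q (x + t *: v) by exact: convex_set_segment.
pose psi (t : R) := h (x + t *: v) - (t * dot (grad h x) v + t ^+ 2 * (L / 2 * N v ^+ 2)).
pose dpsi (t : R) := dot (grad h (x + t *: v)) v
                     - (dot (grad h x) v + 2 * t * (L / 2 * N v ^+ 2)).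
have psiD (t : R) : 0 <= t <= 1 -> is_derive t 1 psi (dpsi t).
  move=> /Qt Qxt; have ht := h_diff _ Qxt.
  have dt : derivable h (x + t *: v) v by exact: diff_derivable.
  have := is_derive_line _ _ _ _ dt.
  rewrite derive_grad // => line'; apply: is_derive_eq.
  rewrite /dpsi; congr (_ - _).
  rewrite /GRing.scale /=; ring.
have [||t t01] := @MVT_segment R psi dpsi 0 1 ler01.
- by move=> t; rewrite in_itv /= => /andP[t0 t1]; apply: psiD; rewrite !ltW.
- apply: derivable_within_continuous => t; rewrite in_itv /= => t01.
  by have [] := psiD _ t01.
rewrite in_itv /= in t01; case/andP: (t01) => t0 t1.
have : dpsi t <= 0.
  have := h_lip _ _ (Qt _ t01) Qx; rewrite addrAC subrr add0r NZ ger0_norm // => hl.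
  have := dot_le_dual_norm _ N_norm (grad h (x + t *: v) - grad h x) v.
  move=> /le_trans /(_ (ler_wpM2r (is_norm_ge0 _ N_norm v) hl)).
  by rewrite dotBl /dpsi => H; rewrite -subr_ge0; move: H; rewrite -subr_ge0; congr (_ <= _); field.
rewrite /psi scale1r scale0r addr0 subrKC.
move=> d0; rewrite subr0 mulr1 => E.
have : h y = h x + dpsi t + (dot (grad h x) v + L / 2 * N v ^+ 2).
  by rewrite -E; ring.
lra.
Qed.

Lemma convex_grad {R : realType} {n : nat} (Q : set 'rV[R]_n)
    (h : 'rV[R]_n -> R) x y :
  convex_function Q h -> Q x -> Q y -> differentiable h x ->
  h x + dot (grad h x) (y - x) <= h y.
Proof.
move=> hc Qx Qy hx; rewrite -lerBrDl -derive_grad //.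
apply: (@derive_le _ _ _ _ _ _ 0); first exact: diff_derivable.
move=> t /andP[t0 t1].
have H : h (t *: y + (1 - t) *: x) <= t * h y + (1 - t) * h x.
  exact: (hc (Itv01 (ltW t0) (ltW t1)) y x (mem_set Qy) (mem_set Qx)).
have -> : x + t *: (y - x) = t *: y + (1 - t) *: x.
  by rewrite scalerBr scalerBl scale1r addrCA.
by rewrite mulr0 addr0; lra.
Qed.

(** Strong convexity bounds the slope over a step [t] by [h y - h x - c + t * c]; the last term
    disappears as [t] tends to 0. *)
Lemma strongly_convex_grad {R : realType} {n : nat} (sigma : R)
    (N : 'rV[R]_n -> R) (Q : set 'rV[R]_n) (h : 'rV[R]_n -> R) x y :
  strongly_convex sigma N Q h -> Q x -> Q y -> differentiable h x ->
  sigma / 2 * N (y - x) ^+ 2 <= bregman h y x.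
Proof.
move=> [_ hc] Qx Qy hx; set c := sigma / 2 * _.
rewrite /bregman lerBrDl -lerBrDr -derive_grad //.
apply: (@derive_le _ _ _ _ _ _ c); first exact: diff_derivable.
move=> t /andP[t0 t1]; have t01 : 0 <= t <= 1 by rewrite !ltW.
have := hc t y x t01 Qy Qx.
have -> : x + t *: (y - x) = t *: y + (1 - t) *: x.
  by rewrite scalerBr scalerBl scale1r addrCA.
move=> H.
have -> : t * (h y - h x - c + t * c) = t * h y + (1 - t) * h x
   - sigma / 2 * (t * (1 - t)) * N (y - x) ^+ 2 - h x by rewrite /c; ring.
lra.
Qed.

(** * Maximizers and quadratic bounds *)

Lemma argmaxP {R : realType} {n : nat} (Q : set 'rV[R]_n) (F : 'rV[R]_n -> R) :
  (exists x, is_argmax Q F x) -> is_argmax Q F (argmax Q F).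
Proof. exact: xgetPex. Qed.

Lemma argminP {R : realType} {n : nat} (Q : set 'rV[R]_n) (F : 'rV[R]_n -> R) :
  (exists x, is_argmin Q F x) -> is_argmin Q F (argmin Q F).
Proof. exact: xgetPex. Qed.

Lemma sup_argmax {R : realType} {n : nat} (Q : set 'rV[R]_n) (F : 'rV[R]_n -> R) x :
  is_argmax Q F x -> sup [set F y | y in Q] = F x.
Proof.
move=> [Qx Fx]; apply/le_anti/andP; split.
  by apply: ge_sup => [|_ [y Qy <-]]; [exists (F x), x | exact: Fx].
by apply: ub_le_sup; [exists (F x) => _ [y Qy <-]; exact: Fx | exists x].
Qed.

Lemma dot_mulmxl {R : realType} {m n : nat} (A : 'M[R]_(m, n)) x y :
  dot (x *m A) y = dot (y *m A^T) x.
Proof.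
transitivity (\sum_j \sum_i x 0 i * A i j * y 0 j).
  by apply: eq_bigr => j _; rewrite mxE mulr_suml.
rewrite exchange_big; apply: eq_bigr => i _; rewrite mxE mulr_suml.
by apply: eq_bigr => j _; rewrite mxE; ring.
Qed.

(** Quadratic growth without differentiability of [f]: the maximizer [x] is compared with points of
    the segment towards [y], and the inequality is divided by [t]. *)
Lemma strongly_convex_argmax {R : realType} {n : nat} (rho : R)
    (N : 'rV[R]_n -> R) (Q : set 'rV[R]_n) (f : 'rV[R]_n -> R) u x y :
  convex_set Q -> strongly_convex rho N Q f ->
  is_argmax Q (fun z => dot u z - f z) x -> Q y ->
  dot u y - f y <= dot u x - f x - rho / 2 * N (y - x) ^+ 2.
Proof.
move=> Qc [rho0 fc] [Qx xmax] Qy.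
set c := rho / 2 * _; set G := dot u y - f y - (dot u x - f x).
have c0 : 0 <= c by rewrite mulr_ge0 ?sqr_ge0 // divr_ge0 // ltW.
have Gt t : 0 < t < 1 -> G + c <= t * c.
  move=> /andP[t0 t1]; have t01 : 0 <= t <= 1 by rewrite !ltW.
  have := xmax _ (convex_setP _ _ _ _ Qc Qy Qx t01).
  rewrite dotDr !dotZr => H1; have := fc t y x t01 Qy Qx.
  have -> : rho / 2 * (t * (1 - t)) * N (y - x) ^+ 2 = t * (1 - t) * c.
    by rewrite /c; ring.
  move=> H2; rewrite -(ler_pM2l t0) /G -subr_ge0.
  have -> : t * (t * c) - t * (dot u y - f y - (dot u x - f x) + c)
    = dot u x - f x - (t * dot u y + (1 - t) * dot u x
       - (t * f y + (1 - t) * f x - t * (1 - t) * c)) by ring.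
  by rewrite subr_ge0 (le_trans _ H1) // lerB.
suff : G + c <= 0 by rewrite /G; lra.
rewrite leNgt; apply/negP => D0.
have cD : 0 < 2 * (c + (G + c)) by lra.
(* An explicit small [t] replaces the limit: if [G + c] were positive, this choice would make
   [t * c] smaller than [G + c]. *)
have := Gt ((G + c) / (2 * (c + (G + c)))).
rewrite divr_gt0 // ltr_pdivrMr // mul1r => /(_ _)/wrap[]; first lra.
rewrite mulrAC ler_pdivlMr // leNgt => /negP; apply.
by rewrite ltr_pM2l //; lra.
Qed.

(** The difference of the two sides is a square divided by [2 * r]. *)
Lemma young_quadratic {R : realFieldType} (K r a b : R) : 0 < r ->
  K * (a * b) - r / 2 * a ^+ 2 <= K ^+ 2 / r / 2 * b ^+ 2.
Proof.
move=> r0; rewrite -subr_ge0.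
have -> : K ^+ 2 / r / 2 * b ^+ 2 - (K * (a * b) - r / 2 * a ^+ 2)
   = (r * a - K * b) ^+ 2 / (2 * r) by field; rewrite gt_eqF.
by rewrite divr_ge0 ?sqr_ge0 // mulr_ge0 // ltW.
Qed.

(** This differentiates a supremum from a two-sided bound whose quadratic error vanishes after
    division by [t]. *)
Lemma is_derive_quadratic {R : realType} {n : nat} (h : 'rV[R]_n -> R) a v c K :
  (forall t, `|h (a + t *: v) - h a - t * c| <= K * t ^+ 2) ->
  is_derive a v h c.
Proof.
move=> hK.
have K0 : 0 <= K by have := hK 1; rewrite expr1n mulr1; apply: le_trans.
have hc : t^-1 *: ((h \o shift a) (t *: v) - h a) @[t --> 0^'] --> c.
  apply/cvgrPdistC_le => e e0; near=> t.
  have t0 : t != 0 by near: t; exact: nbhs_dnbhs_neq.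
  have te : `|t| <= e / (K + 1).
    by near: t; apply: dnbhs0_le; rewrite divr_gt0 // ltr_wpDl.
  have -> : t^-1 *: ((h \o shift a) (t *: v) - h a) - c
            = t^-1 * (h (a + t *: v) - h a - t * c).
    by rewrite mulrBr mulKf //= [t *: v + a]addrC.
  rewrite normrM normfV ler_pdivrMl ?normr_gt0 //; apply: le_trans (hK t) _.
  rewrite -normr_id -real_normK ?num_real // normr_id expr2 mulrCA ler_wpM2l //.
  rewrite (le_trans _ (_ : (K + 1) * (e / (K + 1)) <= _)) //; last first.
    by rewrite mulrC divfK // gt_eqF // ltr_wpDl.
  by apply: ler_pM => //; rewrite lerDl.
by apply: DeriveDef; [apply/cvg_ex; exists c | exact: cvg_lim hc].
Unshelve. all: by end_near. Qed.

(** * Regularity of the dual objective *)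

Section ExcessiveGap.
Context {R : realType} {m n : nat} {Q1 : set 'rV[R]_m} {A : 'M[R]_(m, n)}.
Context {N1 : 'rV[R]_m -> R} {N2 : 'rV[R]_n -> R} {f : 'rV[R]_m -> R} {rho : R}.
Hypotheses (N1_norm : is_norm N1) (N2_norm : is_norm N2).
Hypotheses (Q1_convex : convex_set Q1) (f_sc : strongly_convex rho N1 Q1 f).

(** The convex conjugate of [f] restricted to [Q1], evaluated at [- (a *m A^T)]. *)
Let conj (a : 'rV[R]_n) := sup [set dot (- (w *m A)) a - f w | w in Q1].

(** The point [b] ranges over the whole space: the partial derivatives of [conj] at a boundary point
    of [Q2] involve points outside [Q2]. *)
Lemma conj_bounds a x b :
  is_argmax Q1 (fun w => dot (- (w *m A)) a - f w) x ->
  dot (- (x *m A)) b - f x <= conj b <=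
    dot (- (x *m A)) b - f x + op_norm N1 N2 A ^+ 2 / rho / 2 * N2 (b - a) ^+ 2.
Proof.
move=> xmax; have [Qx _] := xmax; have [rho0 _] := f_sc.
set M := _ + _ * N2 _ ^+ 2.
have ubM w : Q1 w -> dot (- (w *m A)) b - f w <= M.
  move=> Qw.
  (* Transposing [A] exhibits the objective as a linear form in the primal variable minus [f]. *)
  have xmax' : is_argmax Q1 (fun z => dot (- (a *m A^T)) z - f z) x.
    move: xmax; congr is_argmax; apply/funext => z.
    by rewrite !dotNl dot_mulmxl.
  have := strongly_convex_argmax _ _ _ _ _ _ _ Q1_convex f_sc xmax' Qw.
  have := dot_le_op_norm _ _ A (x - w) (b - a) N1_norm N2_norm.
  have := young_quadratic (op_norm N1 N2 A) rho (N1 (x - w)) (N2 (b - a)) rho0.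
  rewrite -(is_normN _ N1_norm (x - w)) opprB /M.
  rewrite mulmxBl !dotNl dotBl !dotBr -!dot_mulmxl; lra.
apply/andP; split.
  by apply: ub_le_sup; [exists M => _ [w Qw <-]; exact: ubM | exists x].
by apply: ge_sup => [|_ [w Qw <-]]; [exists (dot (- (x *m A)) b - f x), x | exact: ubM].
Qed.

Lemma conj_argmax a x : is_argmax Q1 (fun w => dot (- (w *m A)) a - f w) x ->
  conj a = dot (- (x *m A)) a - f x.
Proof. exact: sup_argmax. Qed.

Lemma is_derive_conj a x v : is_argmax Q1 (fun w => dot (- (w *m A)) a - f w) x ->
  is_derive a v conj (dot (- (x *m A)) v).
Proof.
move=> xmax; set K := op_norm N1 N2 A ^+ 2 / rho / 2.
apply: (@is_derive_quadratic _ _ _ _ _ _ (K * N2 v ^+ 2)) => t.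
have := conj_bounds a x (a + t *: v) xmax; rewrite -/K (conj_argmax _ _ xmax).
case: N2_norm => _ NZ _; rewrite dotDr dotZr [a + _ - a]addrAC subrr add0r NZ.
rewrite exprMn real_normK ?num_real // => /andP[lo hi].
by rewrite ger0_norm; [move: hi|]; lra.
Qed.

Context {Q2 : set 'rV[R]_n} {g : 'rV[R]_n -> R} {Lg : R}.
Hypotheses (Q2_convex : convex_set Q2) (g_convex : convex_function Q2 g).
Hypothesis (g_lcg : lcg Lg N2 Q2 g).
Hypothesis w_of_exists : forall a, Q2 a ->
  exists x, is_argmax Q1 (fun x => dot (- (x *m A)) a - f x) x.

Local Notation D := (dual_fun Q1 f g A).
Local Notation w_of := (w_of Q1 f A).

Lemma w_ofP a : Q2 a -> is_argmax Q1 (fun w => dot (- (w *m A)) a - f w) (w_of a).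
Proof. by move=> /w_of_exists; exact: argmaxP. Qed.

Lemma grad_dual_fun a : Q2 a -> grad D a = w_of a *m A - grad g a.
Proof.
move=> Qa; have [g_diff _] := g_lcg; apply/rowP => i; rewrite !mxE.
have conj_i := is_derive_conj a _ (delta_mx 0 i) (w_ofP a Qa).
have g_i : is_derive a (delta_mx 0 i) g ('D_(delta_mx 0 i) g a).
  by apply: DeriveDef => //; apply: diff_derivable; exact: g_diff.
have -> : D = (fun b => - g b - conj b) by [].
by rewrite derive_val dotNl opprK dot_deltar mxE addrC.
Qed.

Lemma dual_fun_descent a b : Q2 a -> Q2 b ->
  D a + dot (grad D a) (b - a)
    - (op_norm N1 N2 A ^+ 2 / rho + Lg) / 2 * N2 (b - a) ^+ 2 <= D b.
Proof.
move=> Qa Qb; rewrite grad_dual_fun // /dual_fun.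
have /andP[_] := conj_bounds a _ b (w_ofP a Qa).
have := lcg_descent _ _ _ _ _ _ N2_norm Q2_convex g_lcg Qa Qb.
rewrite -/(conj a) -/(conj b) (conj_argmax _ _ (w_ofP a Qa)).
by rewrite dotBl !dotNl [dot (_ *m _) (b - a)]dotBr; lra.
Qed.

(** The affine lower bound on [conj] at [a] is added to the gradient inequality for [g]. *)
Lemma dual_fun_concave a b : Q2 a -> Q2 b ->
  D b <= D a + dot (grad D a) (b - a).
Proof.
move=> Qa Qb; rewrite grad_dual_fun // /dual_fun.
have /andP[+ _] := conj_bounds a _ b (w_ofP a Qa).
have [g_diff _] := g_lcg.
have := convex_grad _ _ _ _ g_convex Qa Qb (g_diff _ Qa).
rewrite -/(conj a) -/(conj b) (conj_argmax _ _ (w_ofP a Qa)).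
by rewrite dotBl !dotNl [dot (_ *m _) (b - a)]dotBr; lra.
Qed.

(** At [w_of a] the conjugate part is already affine in [b], so the two sides differ only by the
    linearization error of [g]. *)
Lemma lagrangian_le_dual_linearization a b : Q2 a -> Q2 b ->
  f (w_of a) + dot (w_of a *m A) b - g b <= D a + dot (grad D a) (b - a).
Proof.
move=> Qa Qb; rewrite grad_dual_fun // /dual_fun.
have [g_diff _] := g_lcg.
have := convex_grad _ _ _ _ g_convex Qa Qb (g_diff _ Qa).
rewrite -/(conj a) (conj_argmax _ _ (w_ofP a Qa)).
by rewrite dotBl !dotNl [dot (_ *m _) (b - a)]dotBr; lra.
Qed.

(** * The smoothed primal objective and Bregman projections *)

Context {d : 'rV[R]_n -> R} {sigma : R}.
Hypotheses (Q2_compact : compact Q2) (Q2_neq0 : Q2 !=set0).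
Hypothesis d_sc : strongly_convex sigma N2 Q2 d.
Hypothesis d_diff : forall a, Q2 a -> differentiable d a.

Local Notation L := (op_norm N1 N2 A ^+ 2 / rho + Lg).
Local Notation alpha_of := (alpha_of Q2 g d A).
Local Notation J := (smoothed_primal Q2 f g d A).
Local Notation V := (bregman_proj Q2 d).

Lemma argmax_exists (h : 'rV[R]_n -> R) :
  (forall a, Q2 a -> {for a, continuous h}) -> exists a, is_argmax Q2 h a.
Proof.
move=> hc; have [|a /set_mem Qa amax] := @EVT_max_rV R n h Q2 Q2_neq0 Q2_compact.
  by apply: continuous_in_subspaceT => a /set_mem; exact: hc.
by exists a; split => // b /mem_set; exact: amax.
Qed.

Lemma g_cont a : Q2 a -> {for a, continuous g}.
Proof.
by have [g_diff _] := g_lcg; move=> /g_diff; exact: differentiable_continuous.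
Qed.

Lemma d_cont a : Q2 a -> {for a, continuous d}.
Proof. by move=> /d_diff; exact: differentiable_continuous. Qed.

Lemma alpha_ofP mu w :
  is_argmax Q2 (fun a => dot (w *m A) a - g a - mu * d a) (alpha_of mu w).
Proof.
apply: argmaxP; apply: argmax_exists => a Qa.
have dot_c := dot_continuous (w *m A) a.
exact: (cvgB (cvgB dot_c (g_cont a Qa)) (cvgM (cvg_cst mu) (d_cont a Qa))).
Qed.

Lemma bregman_projP a u :
  is_argmin Q2 (fun b => bregman d b a + dot u (b - a)) (V a u).
Proof.
apply: argminP.
(* Up to a constant in [b], this is the negative of the Bregman objective. *)
have [b Qb|b [Qb bmax]] := @argmax_exists (fun b => - d b - dot (u - grad d a) b).
  have dot_c := dot_continuous (u - grad d a) b.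
  exact: (cvgB (cvgN (d_cont b Qb)) dot_c).
exists b; split => // c /bmax; rewrite /bregman !dotBr !dotBl; lra.
Qed.

Lemma bregman_proj_ascent a G (s : R) b : Q2 b ->
  s * dot G (b - a) - bregman d b a
    <= s * dot G (V a (- s *: G) - a) - bregman d (V a (- s *: G)) a.
Proof.
by have [_ Vmin] := bregman_projP a (- s *: G); move=> /Vmin; rewrite !dotZl; lra.
Qed.

Lemma smoothed_primalE mu w : let a := alpha_of mu w in
  J mu w = f w + (dot (w *m A) a - g a - mu * d a).
Proof. by rewrite /smoothed_primal (sup_argmax _ _ _ (alpha_ofP mu w)). Qed.

(** The first-order optimality condition at [alpha_of mu w] cancels the linear terms. Convexity
    disposes of [g], and [mu * d] leaves exactly its Bregman divergence. *)
Lemma smoothed_primal_bregman mu w b : 0 <= mu -> Q2 b ->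
  f w + (dot (w *m A) b - g b - mu * d b)
    <= J mu w - mu * bregman d b (alpha_of mu w).
Proof.
move=> mu0 Qb; rewrite smoothed_primalE /=; set a := alpha_of mu w.
have [Qa amax] : is_argmax Q2 _ a := alpha_ofP mu w.
have [g_diff _] := g_lcg.
have ga : derivable g a (b - a) by exact/diff_derivable/g_diff.
have da : derivable d a (b - a) by exact/diff_derivable/d_diff.
have opt : dot (w *m A) (b - a) <= dot (grad g a) (b - a) + mu * dot (grad d a) (b - a).
  rewrite -!derive_grad //; last exact: g_diff; last exact: d_diff.
  rewrite -[_ * _]/(mu *: _) -deriveZ // -deriveD //; last exact: derivableZ.
  apply: derive_ge => [|t /andP[t0 t1]]; first by apply: derivableD => //; exact: derivableZ.
  have t01 : 0 <= t <= 1 by rewrite !ltW.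
  have := amax _ (convex_set_segment _ _ _ _ Q2_convex Qa Qb t01).
  set z := a + t *: (b - a) => z_le.
  rewrite -[leRHS]/(g z + mu * d z - (g a + mu * d a)).
  by move: z_le; rewrite {1}/z dotDr dotZr; lra.
have := convex_grad _ _ _ _ g_convex Qa Qb (g_diff _ Qa).
move: opt; rewrite /bregman [dot (w *m A) (b - a)]dotBr; lra.
Qed.

Lemma smoothed_primal_le mu w c :
  (forall b, Q2 b -> f w + (dot (w *m A) b - g b - mu * d b) <= c) -> J mu w <= c.
Proof. by move=> H; rewrite smoothed_primalE; apply: H; have [] := alpha_ofP mu w. Qed.

(** * Base case and inductive step of the excessive gap condition *)

Lemma excessive_gap_init a (mu : R) : 0 < mu -> L <= mu * sigma ->
  is_argmin Q2 d a -> d a = 0 ->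
  J mu (w_of a) <= D (V a (- mu^-1 *: grad D a)).
Proof.
move=> mu0 Lmu [Qa amin] da0; apply: smoothed_primal_le => b Qb.
have [QV _] := bregman_projP a (- mu^-1 *: grad D a).
have := bregman_proj_ascent a (grad D a) mu^-1 b Qb.
set p := V _ _ in QV *; rewrite -(ler_pM2l mu0) [leLHS]mulrBr [leRHS]mulrBr !mulVKf ?gt_eqF // => Vmax.
(* Minimality of [a] for [d] makes this term nonnegative; with [d a = 0] it gives
   [bregman d b a <= d b]. *)
have grad_ge0 : 0 <= dot (grad d a) (b - a).
  rewrite -derive_grad; last exact: d_diff.
  apply: derive_ge => [|t /andP[t0 t1]]; first exact/diff_derivable/d_diff.
  have t01 : 0 <= t <= 1 by rewrite !ltW.
  rewrite mulr0 subr_ge0.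
  exact: (amin _ (convex_set_segment _ _ _ _ Q2_convex Qa Qb t01)).
have breg_le : mu * bregman d b a <= mu * d b.
  by rewrite ler_pM2l // /bregman da0; lra.
(* The divergence of the projected point pays for the quadratic loss in the descent inequality. *)
have Lp : L / 2 * N2 (p - a) ^+ 2 <= mu * bregman d p a.
  apply: (@le_trans _ _ (mu * (sigma / 2 * N2 (p - a) ^+ 2))).
    by rewrite [leRHS]mulrA ler_wpM2r ?sqr_ge0 // mulrA ler_pM2r.
  by rewrite ler_pM2l //; exact: strongly_convex_grad d_sc Qa QV (d_diff _ Qa).
have := lagrangian_le_dual_linearization _ _ Qa Qb.
have := dual_fun_descent _ _ Qa QV.
move: Lp; set Lq := L / 2 * _ => Lp.
lra.
Qed.

Lemma excessive_gap_step (mu tau : R) w a :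
  let a_mu := alpha_of mu w in
  let a_hat := (1 - tau) *: a + tau *: a_mu in
  let a_tilde := V a_mu ((- tau / ((1 - tau) * mu)) *: grad D a_hat) in
  0 < mu -> 0 < tau < 1 -> L * tau ^+ 2 <= (1 - tau) * mu * sigma ->
  Q1 w -> Q2 a -> J mu w <= D a ->
  J ((1 - tau) * mu) ((1 - tau) *: w + tau *: w_of a_hat)
    <= D ((1 - tau) *: a + tau *: a_tilde).
Proof.
move=> a_mu a_hat a_tilde mu0 /andP[tau0 tau1] Ltau Qw Qa gap.
have tau01 : 0 <= 1 - tau <= 1 by apply/andP; split; lra.
have [Qa_mu _] : is_argmax Q2 _ a_mu := alpha_ofP mu w.
have Q2_conv u v : Q2 u -> Q2 v -> Q2 ((1 - tau) *: u + tau *: v).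
  by move=> Qu Qv; rewrite -{2}(subKr 1 tau); exact: convex_setP.
have Qa_hat : Q2 a_hat by exact: Q2_conv.
have [Qa_tilde _] : is_argmin Q2 _ a_tilde := bregman_projP _ _.
have Qa_new := Q2_conv _ _ Qa Qa_tilde.
apply: smoothed_primal_le => b Qb.
set G := grad D a_hat; set nu := (1 - tau) * mu.
have nu0 : 0 < nu by rewrite mulr_gt0 // subr_gt0.
have f_conv : f ((1 - tau) *: w + tau *: w_of a_hat)
    <= (1 - tau) * f w + tau * f (w_of a_hat).
  have [rho0 fc] := f_sc.
  have := fc (1 - tau) w (w_of a_hat) tau01 Qw (w_ofP _ Qa_hat).1.
  rewrite subKr => /le_trans; apply; rewrite gerDl oppr_le0.
  have /andP[tau'0 _] := tau01.
  apply: mulr_ge0 (sqr_ge0 _).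
  by rewrite mulr_ge0 // ?divr_ge0 ?mulr_ge0 // ltW.
have old := smoothed_primal_bregman mu w b (ltW mu0) Qb.
have conc := dual_fun_concave _ _ Qa_hat Qa.
have lin := lagrangian_le_dual_linearization _ _ Qa_hat Qb.
have Vmax : tau * dot G (b - a_mu) - nu * bregman d b a_mu
    <= tau * dot G (a_tilde - a_mu) - nu * bregman d a_tilde a_mu.
  have := bregman_proj_ascent a_mu G (tau / nu) b Qb.
  rewrite -mulNr -/a_tilde -(ler_pM2l nu0) [leLHS]mulrBr [leRHS]mulrBr.
  by rewrite !mulrA [nu * tau]mulrC mulfK // gt_eqF.
have breg := strongly_convex_grad _ _ _ _ _ _ d_sc Qa_mu Qa_tilde (d_diff _ Qa_mu).
have := dual_fun_descent _ _ Qa_hat Qa_new.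
(* The common part [(1 - tau) *: a] cancels, so the quadratic loss carries the factor [tau ^+ 2]. *)
have -> : (1 - tau) *: a + tau *: a_tilde - a_hat = tau *: (a_tilde - a_mu).
  by rewrite /a_hat scalerBr opprD addrACA subrr add0r.
case: N2_norm => _ N2Z _; rewrite -/G dotZr N2Z exprMn real_normK ?num_real //.
set Lq := L / 2 * _ => desc.
have Lbreg : Lq <= nu * bregman d a_tilde a_mu.
  apply: (@le_trans _ _ (nu * (sigma / 2 * N2 (a_tilde - a_mu) ^+ 2))).
    rewrite /Lq mulrA [leRHS]mulrA ler_wpM2r ?sqr_ge0 //.
    by rewrite [leLHS]mulrAC [leRHS]mulrA ler_pM2r.
  by rewrite ler_pM2l.
have split_dir : (1 - tau) * dot G (a - a_hat) + tau * dot G (b - a_hat)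
    = tau * dot G (b - a_mu).
  rewrite -!dotZr -dotDr; congr dot; apply/rowP => i; rewrite !mxE; ring.
(* The hypothesis [gap] and concavity bound [J mu w] by the linearization of [D] at [a_hat]. The
   weight [1 - tau] turns [mu] into the new parameter. *)
have conv_old : (1 - tau) * (f w + (dot (w *m A) b - g b - mu * d b))
    <= (1 - tau) * (D a_hat + dot G (a - a_hat) - mu * bregman d b a_mu).
  by rewrite ler_pM2l ?subr_gt0 //; lra.
have conv_new : tau * (f (w_of a_hat) + dot (w_of a_hat *m A) b - g b)
    <= tau * (D a_hat + dot G (b - a_hat)) by rewrite ler_pM2l.
rewrite mulmxDl -!scalemxAl dotDl !dotZl.
apply: le_trans desc; move: conv_old conv_new Vmax Lbreg f_conv split_dir.
rewrite /nu; lra.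
Qed.

End ExcessiveGap.

(** * Closed form of the smoothing parameters, induction and limit *)

Theorem theorem6 (R : realType) (m n : nat)
  (Q1 : set 'rV[R]_m) (Q2 : set 'rV[R]_n) (A : 'M[R]_(m, n))
  (N1 : 'rV[R]_m -> R) (N2 : 'rV[R]_n -> R)
  (f : 'rV[R]_m -> R) (g d : 'rV[R]_n -> R)
  (rho Lg sigma L : R) (alpha0 : 'rV[R]_n)
  (w : nat -> 'rV[R]_m) (alpha : nat -> 'rV[R]_n) (mu : nat -> R)
  (N1_norm : is_norm N1) (N2_norm : is_norm N2)
  (Q1_convex : convex_set Q1) (Q2_convex : convex_set Q2)
  (Q2_compact : compact Q2)
  (f_sc : strongly_convex rho N1 Q1 f)
  (g_convex : convex_function Q2 g)
  (g_lcg : lcg Lg N2 Q2 g)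
  (d_sc : strongly_convex sigma N2 Q2 d)
  (d_smooth : forall a, Q2 a -> differentiable d a)
  (alpha0_argmin : is_argmin Q2 d alpha0)
  (d_min0 : d alpha0 = 0)
  (d_bounded : has_ubound [set d a | a in Q2])
  (* the maximum over Q1 in the definition of the dual objective is attained *)
  (w_of_exists : forall a, Q2 a ->
     exists x, is_argmax Q1 (fun x => dot (- (x *m A)) a - f x) x)
  (strong_duality : inf [set primal Q2 f g A x | x in Q1]
                    = sup [set dual_fun Q1 f g A a | a in Q2])
  (weak_duality : forall x a, Q1 x -> Q2 a ->
     dual_fun Q1 f g A a <= primal Q2 f g A x)
  (L_def : L = op_norm N1 N2 A ^+ 2 / rho + Lg)
  (L_gt0 : 0 < L)
  (egm : egm_sequences Q1 Q2 f g d A L sigma alpha0 w alpha mu) :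
  (forall k : nat, (1 <= k)%N ->
     smoothed_primal Q2 f g d A (mu k) (w k) <= dual_fun Q1 f g A (alpha k))
  /\ mu k @[k --> \oo] --> (0 : R).
Proof.
have [sigma0 _] := d_sc; have [Qalpha0 _] := alpha0_argmin.
have Q2_neq0 : Q2 !=set0 by exists alpha0.
have [mu1 w1 alpha1 egmS] := egm.
have nat_ge0 k : 0 <= k%:R :> R by [].
(* The index is shifted by one, so the factor is [1 - 2 / (k + 4) = (k + 2) / (k + 4)] and the
   product telescopes; 6 is the value of [(k + 2) * (k + 3)] at [k = 0]. *)
have mu_eq k : mu k.+1 = 6 * L / (sigma * ((k%:R + 2) * (k%:R + 3))).
  elim: k => [|k IH]; first by rewrite mu1 !add0r; field; rewrite gt_eqF.
  have [_ _ ->] := egmS k.+1 isT; rewrite IH natrD -natr1.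
  by have := nat_ge0 k => k0; field; rewrite !gt_eqF //; lra.
have mu_gt0 k : 0 < mu k.+1.
  have := nat_ge0 k; rewrite mu_eq => k0.
  by rewrite divr_gt0 ?mulr_gt0 //; lra.
have w_ofQ a (Qa : Q2 a) := (argmaxP _ _ (w_of_exists a Qa)).1.
have VQ a u := (bregman_projP Q2_compact Q2_neq0 d_smooth a u).1.
(* Feasibility of both iterates joins the induction, because the step requires it. *)
have excessive_gap k : [/\ Q1 (w k.+1), Q2 (alpha k.+1) &
    smoothed_primal Q2 f g d A (mu k.+1) (w k.+1) <= dual_fun Q1 f g A (alpha k.+1)].
  elim: k => [|k [Qw Qa gap]].
    rewrite w1 alpha1; split; [exact: w_ofQ | exact: VQ |].
    apply: (excessive_gap_init N1_norm N2_norm Q1_convex f_sc Q2_convex g_convex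
      g_lcg w_of_exists Q2_compact Q2_neq0 d_sc d_smooth) => //.
    by rewrite mu1 divfK ?gt_eqF // L_def.
  have [] := egmS k.+1 isT; set tau : R := 2 / _; move=> -> -> ->.
  have k0 := nat_ge0 k.
  have tau_eq : tau = 2 / (k%:R + 4).
    by rewrite /tau natrD -[k.+1%:R]natr1; congr (_ / _); lra.
  have tau01 : 0 < tau < 1 by rewrite tau_eq divr_gt0 ?ltr_pdivrMr /=; lra.
  have [tau0 tau1] := andP tau01.
  have tau'01 : 0 <= 1 - tau <= 1 by apply/andP; split; lra.
  have Q2_conv u v : Q2 u -> Q2 v -> Q2 ((1 - tau) *: u + tau *: v).
    by move=> Qu Qv; rewrite -{2}(subKr 1 tau); exact: convex_setP.
  have Qa_mu := (alpha_ofP (A := A) g_lcg Q2_compact Q2_neq0 d_smooth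
    (mu k.+1) (w k.+1)).1.
  have Qa_hat := Q2_conv _ _ Qa Qa_mu.
  split.
  - by rewrite -{2}(subKr 1 tau); apply: convex_setP => //; exact: w_ofQ.
  - exact: Q2_conv.
  apply: (excessive_gap_step N1_norm N2_norm Q1_convex f_sc Q2_convex g_convex
    g_lcg w_of_exists Q2_compact Q2_neq0 d_sc d_smooth) => //.
  rewrite -L_def mu_eq tau_eq -subr_ge0.
  (* The slack in the step-size condition; its numerator comes from [6 * (k + 4) - 4 * (k + 3)]. *)
  have -> : (1 - 2 / (k%:R + 4)) * (6 * L / (sigma * ((k%:R + 2) * (k%:R + 3)))) * sigma
      - L * (2 / (k%:R + 4)) ^+ 2
      = L * (2 * k%:R + 12) / ((k%:R + 3) * (k%:R + 4) ^+ 2).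
    by field; rewrite !gt_eqF //; lra.
  by rewrite divr_ge0 ?mulr_ge0 ?exprn_ge0 //; lra.
split; first by case=> // k _; have [] := excessive_gap k.
rewrite -cvg_shiftS.
(* Since [(k + 2) * (k + 3) >= k + 1], a multiple of the harmonic sequence dominates [mu k.+1]. *)
have harmonic0 : (6 * L / sigma) * harmonic k @[k --> \oo] --> (0 : R).
  rewrite -[X in _ --> X](mulr0 (6 * L / sigma)).
  by apply: cvgM; [exact: cvg_cst | exact: cvg_harmonic].
apply: squeeze_cvgr (cvg_cst 0) harmonic0; near=> k.
rewrite ltW //= mu_eq invfM mulrA ler_wpM2l //.
  by rewrite ltW // !divr_gt0 ?mulr_gt0.
have k0 := nat_ge0 k.
by rewrite -natr1 lef_pV2 ?posrE ?mulr_gt0 //; nra.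
Unshelve. all: by end_near. Qed.
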